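(* Let $k_1,k_2$ be fixed positive integers. For every $\varepsilon>0$ there exists $c=c(k_1,k_2,\varepsilon)>0$ such that the following holds for every prime $p$. Let $I_1,I_2\subset\mathbb{F}_p\setminus\{0\}$ be intervals of sizes $N_1,N_2$ in arbitrary position with $$N_1<p^{\frac{k_1+1}{2k_1}},\qquad N_2<p^{\frac{k_2+1}{2k_2}},$$ and let $\alpha_1(x_1)$ $(x_1\in I_1)$ and $\alpha_2(x_2)$ $(x_2\in I_2)$ be arbitrary complex numbers with $|\alpha_i(x_i)|\le1$. Then $$\max_{(a,p)=1}\left|\sum_{x_1\in I_1}\sum_{x_2\in I_2}\alpha_1(x_1)\alpha_2(x_2)e_p(ax_1^*x_2^* )\right|<c\left(p^{\frac{1}{2k_1k_2}}N_1^{-\frac{1}{k_2(k_1+1)}}N_2^{-\frac{1}{k_1(k_2+1)}}\right)(N_1N_2)^{1+\varepsilon}.$$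
   Context: $\mathbb{F}_p$ is the field of residue classes modulo $p$, $x^*$ is the multiplicative inverse of $x$ modulo $p$, and $e_p(z)=e^{2\pi i z/p}$. An interval in $\mathbb{F}_p$ is a non-empty set of residue classes of consecutive integers $M+1,\dots,M+N$ with $1\le N\le p$; its size is $N$. The maximum is over integers $a$ coprime to $p$. *)

(* Defs.v *)
From HB Require Import structures.
From mathcomp Require Import all_boot all_order all_algebra.
From mathcomp Require Import complex.
From mathcomp Require Import reals exp trigo.

Set Implicit Arguments.
Unset Strict Implicit.
Unset Printing Implicit Defensive.

Import Order.TTheory GRing.Theory Num.Theory.

Local Open Scope ring_scope.
Local Open Scope complex_scope.

(* [e_ R z] is e^(2 pi i z / p), computed on the representative of z in
   {0, ..., p-1}; the value does not depend on the representative. As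
   everywhere with 'F_p, this is intended for p prime. *)
Definition e_ (R : realType) (p : nat) (z : 'F_p) : R[i] :=
  let t : R := 2 * pi * (z : nat)%:R / p%:R in cos t +i* sin t.

(* The classes of M+1, ..., M+N; for p prime the bound N <= p makes them
   pairwise distinct, so that #|I| = N. *)
Definition is_interval (p N : nat) (I : {set 'F_p}) : Prop :=
  (1 <= N <= p)%N /\
  exists M : int, I = [set (M + i.+1%:Z)%:~R | i : 'I_N].

Definition bilinear_Kloosterman_sum (R : realType) (p : nat)
    (I1 I2 : {set 'F_p}) (alpha1 alpha2 : 'F_p -> R[i]) (a : int) : R[i] :=
  \sum_(x1 in I1) \sum_(x2 in I2)
     alpha1 x1 * alpha2 x2 * e_ R (a%:~R * x1^-1 * x2^-1).

(* Main.v *)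
(** Two applications of Hoelder's inequality, Cauchy-Schwarz and Parseval bound
    the [2 k1 k2]-th power of the bilinear sum by
    [N1^(2 k1 k2 - 2 k1) N2^(2 k1 k2 - 2 k2) p J1 J2], where [J_i] is the number
    of solutions of [1/x_1 + ... + 1/x_k = 1/x_(k+1) + ... + 1/x_(2k)] with
    [k = k_i] and all [x_j] in [I_i]. It remains to show that
    [J <= N^(2 k^2 / (k+1) + o(1))] when [N < p^((k+1) / (2k))].

    Write [x = x' + t u] with [0 <= t < T], [1 <= u <= U], [T ~ N^(2 / (k+1))]
    and [T U ~ N]. By Hoelder, [J] is controlled by the average over the pairs
    [(x', u)] of the number of tuples [t_1, ..., t_2k] such that [y = x' / u]
    solves [sum +-1/(y + t_j) = 0]. Either every value [t_j] is repeated, which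
    leaves [O(T^k)] tuples, or the equation has at most [2k] roots [y]. The second
    case is harmless if few pairs share the same quotient [y]. If many do, two of
    them are close by the pigeonhole principle, so that [x e = w] in F_p for some
    [1 <= e <= U / H] and some integer [w] divisible by [u] with
    [|w| <= 3 N U / H < p / 2]. Such a [w] is determined by [x] and [e], so by the
    divisor bound this can happen, for a given [x], for at most half of the [u];
    these bad [u] are discarded from the start. *)

Require Import Defs.
From HB Require Import structures.
From mathcomp Require Import all_boot all_order all_algebra.
From mathcomp Require Import complex.
From mathcomp Require Import reals exp trigo.
From mathcomp Require Import zify ring lra.

Set Implicit Arguments.
Unset Strict Implicit.
Unset Printing Implicit Defensive.

Import Order.TTheory GRing.Theory Num.Theory.
Local Open Scope ring_scope.
Local Open Scope complex_scope.

(** * Power means and additive characters *)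

(** Chebyshev's sum inequality: twice the difference of the sides is the sum over pairs of
    [(r i ^+ n - r j ^+ n) * (r i - r j)], whose two factors have the same sign. *)
Lemma sum_exp_mul_le {F : numDomainType} {I : finType} (P : pred I) (r : I -> F)
    (n : nat) : (forall i, 0 <= r i) ->
  (\sum_(i | P i) r i ^+ n) * (\sum_(i | P i) r i) <=
  #|P|%:R * \sum_(i | P i) r i ^+ n.+1.
Proof.
move=> r0.
rewrite -(ler_pMn2r (ltn0Sn 1)) !mulr2n.
have -> : (\sum_(i | P i) r i ^+ n) * (\sum_(i | P i) r i)
  + (\sum_(i | P i) r i ^+ n) * (\sum_(i | P i) r i)
  = \sum_(i | P i) \sum_(j | P j) (r i ^+ n * r j + r j ^+ n * r i).
  under [RHS]eq_bigr do rewrite big_split /=.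
  rewrite big_split /= -big_distrlr; congr (_ + _).
  by rewrite exchange_big -big_distrlr.
have -> : #|P|%:R * (\sum_(i | P i) r i ^+ n.+1)
  + #|P|%:R * (\sum_(i | P i) r i ^+ n.+1)
  = \sum_(i | P i) \sum_(j | P j) (r i ^+ n.+1 + r j ^+ n.+1).
  under [RHS]eq_bigr do rewrite big_split /= sumr_const.
  rewrite big_split /= sumr_const sumrMnl mulr_natl; congr (_ + _).
apply: ler_sum => i _; apply: ler_sum => j _.
rewrite -subr_ge0.
have -> : r i ^+ n.+1 + r j ^+ n.+1 - (r i ^+ n * r j + r j ^+ n * r i)
  = (r i ^+ n - r j ^+ n) * (r i - r j) by rewrite !exprS; ring.
rewrite subrXX mulrAC -expr2 mulr_ge0 //.
  by rewrite real_exprn_even_ge0 // rpredB // ger0_real.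
by apply: sumr_ge0 => k _; rewrite mulr_ge0 // exprn_ge0.
Qed.

Lemma power_mean {F : numDomainType} {I : finType} (P : pred I) (r : I -> F)
    (n : nat) : (forall i, 0 <= r i) ->
  (\sum_(i | P i) r i) ^+ n.+1 <= #|P|%:R ^+ n * \sum_(i | P i) r i ^+ n.+1.
Proof.
move=> r0; elim: n => [|n IHn]; first by rewrite expr0 mul1r.
rewrite exprSr.
apply: le_trans (ler_wpM2r (sumr_ge0 _ (fun i _ => r0 i)) IHn) _.
rewrite -mulrA exprSr -mulrA.
by rewrite ler_wpM2l ?exprn_ge0 // sum_exp_mul_le.
Qed.

(** After the triangle inequality, the doubled difference is a sum of squares over pairs, as in
    Lagrange's identity. *)
Lemma Cauchy_Schwarz_sum {C : numClosedFieldType} {I : finType} (f g : I -> C) :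
  `|\sum_i f i * g i| ^+ 2 <= (\sum_i `|f i| ^+ 2) * (\sum_i `|g i| ^+ 2).
Proof.
apply: (@le_trans _ _ ((\sum_i `|f i| * `|g i|) ^+ 2)).
  rewrite ler_pXn2r ?nnegrE ?sumr_ge0 //; last by move=> i _; rewrite mulr_ge0.
  by apply: le_trans (ler_norm_sum _ _ _) _; apply: ler_sum => i _; rewrite normrM.
rewrite expr2 -(ler_pMn2r (ltn0Sn 1)) [leRHS]mulr2n [X in _ <= _ + X]mulrC.
rewrite !big_distrlr /= -big_split -sumrMnl /=.
apply: ler_sum => i _; rewrite -big_split -sumrMnl /=; apply: ler_sum => j _.
rewrite mulr2n.
rewrite -subr_ge0.
have -> : `|f i| ^+ 2 * `|g j| ^+ 2 + `|g i| ^+ 2 * `|f j| ^+ 2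
   - (`|f i| * `|g i| * (`|f j| * `|g j|) + `|f i| * `|g i| * (`|f j| * `|g j|))
   = (`|f i| * `|g j| - `|g i| * `|f j|) ^+ 2 by ring.
by rewrite real_exprn_even_ge0 // rpredB // rpredM // ger0_real.
Qed.

(** The third clause expresses nontriviality by the vanishing of complete sums, the form that
    orthogonality requires. *)
Definition additive_char (C : numClosedFieldType) (p : nat) (e : 'F_p -> C) :=
  [/\ {morph e : x y / x + y >-> x * y},
      forall x, `|e x| = 1 &
      forall x, x != 0 -> \sum_a e (a * x) = 0].

Section Characters.
Variables (C : numClosedFieldType) (p : nat) (e : 'F_p -> C).
Hypotheses (pr_p : prime p) (e_char : additive_char e).

Lemma char0 : e 0 = 1.
Proof.
case: e_char => eD en _.
have e0 : e 0 != 0 by rewrite -normr_eq0 en oner_eq0.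
by apply: (mulfI e0); rewrite -eD addr0 mulr1.
Qed.

Lemma char_conj x : ((e x)^*)%R = e (- x).
Proof.
case: e_char => eD en _.
have e0 : e x != 0 by rewrite -normr_eq0 en oner_eq0.
by apply: (mulfI e0); rewrite -eD subrr char0 -normCK en expr1n.
Qed.

Lemma char_sum {I : finType} (P : pred I) (g : I -> 'F_p) :
  e (\sum_(i | P i) g i) = \prod_(i | P i) e (g i).
Proof. by case: e_char => eD _ _; rewrite (big_morph e eD char0). Qed.

Lemma char_orthogonality x : \sum_a e (a * x) = (p * (x == 0))%:R.
Proof.
have [->|x0] := eqVneq x 0; last by case: e_char => _ _ ->; rewrite ?muln0.
under eq_bigr do rewrite mulr0 char0.
by rewrite sumr_const card_Fp // muln1.
Qed.

Lemma Parseval (r : 'F_p -> C) :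
  \sum_a `|\sum_x r x * e (a * x)| ^+ 2 = p%:R * \sum_x `|r x| ^+ 2.
Proof.
case: e_char => eD _ _.
under eq_bigr => a _.
  rewrite normCK rmorph_sum big_distrlr /=.
  under eq_bigr => x _.
    under eq_bigr => y _.
      rewrite rmorphM /= char_conj mulrACA -eD -mulrBr.
    over.
  over.
over.
rewrite exchange_big mulr_sumr; apply: eq_bigr => x _.
rewrite exchange_big (bigD1 x) //= [X in _ + X]big1 => [|y yx].
  by rewrite -mulr_sumr char_orthogonality subrr eqxx muln1 addr0 -normCK mulrC.
rewrite -mulr_sumr char_orthogonality subr_eq0 eq_sym (negPf yx).
by rewrite muln0 mulr0.
Qed.

End Characters.

(** * Energies and bilinear sums *)

(** The Boolean in an index is the side of the equation: [false] carries the sign plus, [true] the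
    sign minus. *)
Definition signed_sum (p k : nat) {X : finType} (g : X -> 'F_p)
    (v : {ffun bool * 'I_k -> X}) : 'F_p :=
  \sum_(j : bool * 'I_k) (-1) ^+ j.1 * g (v j).

(* For [c = 1] this counts the solutions of
   [g x_1 + ... + g x_k = g x_(k+1) + ... + g x_(2k)]. *)
Definition energy (p k : nat) {X : finType} (c : X -> nat) (g : X -> 'F_p) : nat :=
  (\sum_(v : {ffun bool * 'I_k -> X} | signed_sum g v == 0%R) \prod_j c (v j))%N.

Section Energy.
Variables (C : numClosedFieldType) (p : nat) (e : 'F_p -> C).
Hypotheses (pr_p : prime p) (e_char : additive_char e).

Lemma char_sum_exp (k : nat) {X : finType} (alpha : X -> C) (g : X -> 'F_p) a :
  (\sum_x alpha x * e (a * g x)) ^+ k =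
  \sum_(w : {ffun 'I_k -> X})
     (\prod_i alpha (w i)) * e (a * \sum_i g (w i)).
Proof.
rewrite -[k in LHS]card_ord -prodr_const bigA_distr_bigA.
apply: eq_bigr => w _; rewrite big_split /= mulr_sumr.
by rewrite (char_sum e_char).
Qed.

(** Conjugation flips the sign inside [e], so the power is a product over [bool * 'I_k].
    Distributing it produces the signed sums, and summing over [a] keeps those that vanish. *)
Lemma energy_moment (k : nat) {X : finType} (c : X -> nat) (g : X -> 'F_p) :
  \sum_a `|\sum_x (c x)%:R * e (a * g x)| ^+ (2 * k) = (p * energy k c g)%:R.
Proof.
have expE (z : C) : z ^+ k = \prod_(i < k) z by rewrite prodr_const card_ord.
under eq_bigr => a _.
  rewrite exprM normCK.
  have -> : (\sum_x (c x)%:R * e (a * g x)) * ((\sum_x (c x)%:R * e (a * g x))^*)%R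
     = \prod_(b : bool) \sum_x (c x)%:R * e (a * ((-1) ^+ b * g x)).
    rewrite big_bool mulrC expr0 expr1; congr (_ * _).
      rewrite rmorph_sum; apply: eq_bigr => x _.
      by rewrite rmorphM /= conjC_nat (char_conj e_char) mulN1r mulrN.
    by apply: eq_bigr => x _; rewrite mul1r.
  rewrite -prodrXl.
  under eq_bigr do rewrite expE.
  rewrite (pair_bigA _ (fun (b : bool) (i : 'I_k) =>
     \sum_x (c x)%:R * e (a * ((-1) ^+ b * g x)))) /=.
  rewrite bigA_distr_bigA /=.
  under eq_bigr => v _.
    rewrite big_split /= -(char_sum e_char) -mulr_sumr -natr_prod.
  over.
over.
rewrite exchange_big /= natrM natr_sum mulr_sumr [RHS]big_mkcond /=.
apply: eq_bigr => v _; rewrite -mulr_sumr (char_orthogonality pr_p e_char).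
rewrite /signed_sum; case: eqP => _; last by rewrite muln0 mulr0.
by rewrite muln1 mulrC.
Qed.

(** The hypothesis says that the weighted values of [g] split into families indexed by [Q]. It is
    used for characters [phi]: the power mean over [Q] is applied inside the moment formula. *)
Lemma energy_Hoelder (k : nat) {X Y Q : finType} (c : X -> nat) (g : X -> 'F_p)
    (c' : Q -> Y -> nat) (g' : Q -> Y -> 'F_p) : (0 < k)%N ->
  (forall phi : 'F_p -> C,
     \sum_x (c x)%:R * phi (g x) = \sum_q \sum_y (c' q y)%:R * phi (g' q y)) ->
  (energy k c g <= #|Q| ^ (2 * k).-1 * \sum_q energy k (c' q) (g' q))%N.
Proof.
move=> k0 cc'.
have p0 : (0 < p)%N by apply: prime_gt0.
rewrite -(leq_pmul2l p0) -(ler_nat C) -energy_moment mulnCA natrM natrX.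
rewrite big_distrr /= natr_sum.
under [X in _ <= _ * X]eq_bigr do rewrite -energy_moment.
rewrite exchange_big /= mulr_sumr.
have k2 : (2 * k)%N = (2 * k).-1.+1 by lia.
apply: ler_sum => a _.
rewrite (cc' (fun x => e (a * x))) {2 3}k2 {1}k2.
apply: (le_trans _ (power_mean _ _ (fun q => normr_ge0 _))).
by rewrite ler_pXn2r ?nnegrE ?sumr_ge0 // ler_norm_sum.
Qed.

Definition reps (k : nat) {X : finType} (g : X -> 'F_p) (x : 'F_p) : nat :=
  #|[pred w : {ffun 'I_k -> X} | \sum_i g (w i) == x]|.

(** Multiplied by [p], both sides are the same moment, once by Parseval and once by
    [energy_moment]. *)
Lemma sum_reps_sq (k : nat) {X : finType} (g : X -> 'F_p) :
  (\sum_x reps k g x ^ 2)%N = energy k (fun=> 1%N) g.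
Proof.
have p0 : (0 < p)%N by apply: prime_gt0.
apply/eqP; rewrite -(eqn_pmul2l p0) -(eqr_nat C) -energy_moment natrM natr_sum.
under eq_bigr do rewrite natrX -[X in X ^+ 2]normr_nat.
rewrite -(Parseval pr_p e_char (fun x => (reps k g x)%:R)).
apply/eqP; apply: eq_bigr => a _; rewrite exprM [RHS]exprAC -[X in _ = X ^+ 2]normrX char_sum_exp.
congr (`|_| ^+ 2).
rewrite [RHS](partition_big (fun w : {ffun 'I_k -> X} => \sum_i g (w i)) predT) //=.
apply: eq_bigr => x _; rewrite /reps.
under [RHS]eq_bigr => w /eqP -> do rewrite big1 // mul1r.
by rewrite sumr_const mulr_natl.
Qed.

Lemma sum_fiber_norm_sq_le (k : nat) {X : finType} (g : X -> 'F_p)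
    (om : {ffun 'I_k -> X} -> C) : (forall w, `|om w| <= 1) ->
  \sum_x `|\sum_(w : {ffun 'I_k -> X} | \sum_i g (w i) == x) om w| ^+ 2 <=
  (energy k (fun=> 1%N) g)%:R.
Proof.
move=> om1; rewrite -sum_reps_sq natr_sum; apply: ler_sum => x _.
rewrite natrX ler_pXn2r ?nnegrE //.
apply: le_trans (ler_norm_sum _ _ _) _.
apply: le_trans (ler_sum _ (fun w _ => om1 w)) _.
by rewrite sumr_const.
Qed.

Lemma phase_exists (z : C) : exists t : C, `|t| <= 1 /\ t * z = `|z|.
Proof.
have [->|z0] := eqVneq z 0; first by exists 0; rewrite normr0 mul0r ler01.
exists (`|z| / z); rewrite mulfVK // normrM normfV normr_id.
by rewrite mulfV ?normr_eq0.
Qed.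

(** Phases make a sum of norms linear in [F], so that the order of summation can be exchanged. *)
Lemma phase_choice {I : finType} (F : I -> C) :
  exists t : I -> C, (forall i, `|t i| <= 1) /\ (forall i, t i * F i = `|F i|).
Proof.
have /fin_all_exists [t tP] : forall i, exists s : C, `|s| <= 1 /\ s * F i = `|F i|.
  by move=> i; apply: phase_exists.
by exists t; split=> i; case: (tP i).
Qed.

Lemma norm_prod_le1 {I : finType} (F : I -> C) :
  (forall i, `|F i| <= 1) -> `|\prod_i F i| <= 1.
Proof. by move=> F1; rewrite normr_prod prodr_ile1 // => i _; rewrite normr_ge0 F1. Qed.

(** Group the tuples by the values [l] and [m] of their sums. Cauchy-Schwarz in [l] and Parseval for
    the transform [K] of the weights on [m] leave two energies and the factor [p]. *)
Lemma reps_bilinear_le (k1 k2 : nat) {A B : finType} (h1 : A -> 'F_p)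
    (h2 : B -> 'F_p) (om : {ffun 'I_k1 -> A} -> C) (th : {ffun 'I_k2 -> B} -> C) :
  (forall v, `|om v| <= 1) -> (forall w, `|th w| <= 1) ->
  `|\sum_(v : {ffun 'I_k1 -> A}) om v * \sum_(w : {ffun 'I_k2 -> B})
       th w * e ((\sum_i h1 (v i)) * \sum_i h2 (w i))| ^+ 2 <=
  (p * energy k1 (fun=> 1%N) h1 * energy k2 (fun=> 1%N) h2)%:R.
Proof.
move=> om1 th1.
pose K l := \sum_(w : {ffun 'I_k2 -> B}) th w * e (l * \sum_i h2 (w i)).
have -> : \sum_(v : {ffun 'I_k1 -> A}) om v * \sum_(w : {ffun 'I_k2 -> B})
      th w * e ((\sum_i h1 (v i)) * \sum_i h2 (w i))
    = \sum_l (\sum_(v : {ffun 'I_k1 -> A} | \sum_i h1 (v i) == l) om v) * K l.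
  rewrite [LHS](partition_big (fun v : {ffun 'I_k1 -> A} => \sum_i h1 (v i)) predT) //=.
  by apply: eq_bigr => l _; rewrite mulr_suml; apply: eq_bigr => v /eqP ->.
apply: le_trans (Cauchy_Schwarz_sum _ _) _.
have KE l : K l =
    \sum_m (\sum_(w : {ffun 'I_k2 -> B} | \sum_i h2 (w i) == m) th w) * e (l * m).
  rewrite /K [LHS](partition_big (fun w : {ffun 'I_k2 -> B} => \sum_i h2 (w i)) predT) //=.
  by apply: eq_bigr => m _; rewrite mulr_suml; apply: eq_bigr => w /eqP ->.
under [X in _ * X <= _]eq_bigr do rewrite KE.
rewrite (Parseval pr_p e_char) mulrCA -mulnA natrM ler_wpM2l // natrM.
by apply: ler_pM; rewrite ?sum_fiber_norm_sq_le // sumr_ge0 // => i _; rewrite exprn_ge0.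
Qed.

Lemma bilinear_le_energy (k1 k2 : nat) {A B : finType} (h1 : A -> 'F_p)
    (h2 : B -> 'F_p) (al : A -> C) (be : B -> C) :
  (0 < k1)%N -> (0 < k2)%N ->
  (forall x, `|al x| <= 1) -> (forall y, `|be y| <= 1) ->
  `|\sum_x \sum_y al x * be y * e (h1 x * h2 y)| ^+ (2 * k1 * k2) <=
  (#|A| ^ (2 * k1 * k2.-1) * #|B| ^ (2 * k2 * k1.-1)
     * (p * energy k1 (fun=> 1%N) h1 * energy k2 (fun=> 1%N) h2))%:R.
Proof.
move=> k1_gt0 k2_gt0 al1 be1.
pose F y := \sum_x al x * e (h2 y * h1 x).
have k1E : k1 = k1.-1.+1 by lia.
have k2E : k2 = k2.-1.+1 by lia.
have [th [th1 thF]] := phase_choice (fun y => F y ^+ k1).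
pose H1 (v : {ffun 'I_k1 -> A}) := \sum_i h1 (v i).
pose G v := \sum_y th y * e (H1 v * h2 y).
have S1 : `|\sum_x \sum_y al x * be y * e (h1 x * h2 y)| <= \sum_y `|F y|.
  rewrite exchange_big /=; apply: le_trans (ler_norm_sum _ _ _) _.
  apply: ler_sum => y _.
  have -> : \sum_x al x * be y * e (h1 x * h2 y) = be y * F y.
    by rewrite mulr_sumr; apply: eq_bigr => x _; rewrite mulrCA mulrA [h1 x * _]mulrC.
  by rewrite normrM ler_piMl.
(* First Hoelder step, over [y]: the [k1]-th power of [F y] opens into tuples [v] of points of [A],
   and the phases [th] allow the sum over [y] to go inside. *)
have S2 : (\sum_y `|F y|) ^+ k1 <= #|B|%:R ^+ k1.-1 * \sum_v `|G v|.
  rewrite {1}k1E.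
  apply: le_trans (power_mean _ _ (fun y => normr_ge0 (F y))) _.
  rewrite -k1E ler_wpM2l ?exprn_ge0 //.
  under eq_bigr do rewrite -normrX -thF char_sum_exp mulr_sumr.
  rewrite exchange_big /=.
  rewrite -[leLHS]ger0_norm; last first.
    rewrite exchange_big; apply: sumr_ge0 => y _.
    by rewrite -mulr_sumr -char_sum_exp thF.
  apply: le_trans (ler_norm_sum _ _ _) _; apply: ler_sum => v _.
  have -> : \sum_y th y * ((\prod_i al (v i)) * e (h2 y * \sum_i h1 (v i)))
      = (\prod_i al (v i)) * G v.
    by rewrite mulr_sumr; apply: eq_bigr => y _; rewrite mulrCA [h2 y * _]mulrC.
  by rewrite normrM ler_piMl // norm_prod_le1.
have [om [om1 omG]] := phase_choice (fun v => G v ^+ k2).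
(* Second Hoelder step, over the [#|A| ^ k1] tuples [v], which explains the exponent
   [k1 * k2.-1]. *)
have S3 : (\sum_v `|G v|) ^+ k2 <= #|A|%:R ^+ (k1 * k2.-1) *
   `|\sum_v om v * \sum_(w : {ffun 'I_k2 -> B}) (\prod_i th (w i))
        * e (H1 v * \sum_i h2 (w i))|.
  rewrite {1}k2E.
  apply: le_trans (power_mean _ _ (fun v => normr_ge0 (G v))) _.
  rewrite -k2E card_ffun card_ord natrX -exprM ler_wpM2l ?exprn_ge0 //.
  rewrite [leRHS]ger0_norm; last first.
    by apply: sumr_ge0 => v _; rewrite -char_sum_exp omG.
  by apply: ler_sum => v _; rewrite -char_sum_exp omG normrX.
have S4 := reps_bilinear_le h1 h2 om1 (fun w : {ffun 'I_k2 -> B} =>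
   norm_prod_le1 (fun i => th1 (w i))).
have -> : (2 * k1 * k2 = k1 * k2 * 2)%N by lia.
have pow_le x y n : 0 <= x -> x <= y -> x ^+ n <= y ^+ n :> C.
  by move=> x0 xy; apply: lerXn2r; rewrite ?nnegrE // (le_trans x0).
rewrite exprM [in leLHS]exprM.
have X2 := pow_le _ _ k2 (exprn_ge0 k1 (normr_ge0 _))
  (le_trans (pow_le _ _ k1 (normr_ge0 _) S1) S2).
rewrite exprMn in X2.
have X3 := le_trans X2 (ler_wpM2l (exprn_ge0 k2 (exprn_ge0 k1.-1 (ler0n _ #|B|))) S3).
have X4 := pow_le _ _ 2 (exprn_ge0 k2 (exprn_ge0 k1 (normr_ge0 _))) X3.
apply: le_trans X4 _.
rewrite !exprMn -!exprM mulrA natrM natrM !natrX [X in _ <= X * _]mulrC.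
have -> : (k1.-1 * k2 * 2 = 2 * k2 * k1.-1)%N by lia.
have -> : (k1 * k2.-1 * 2 = 2 * k1 * k2.-1)%N by lia.
by apply: ler_wpM2l S4; rewrite mulr_ge0 // exprn_ge0.
Qed.

End Energy.

(** * The divisor bound *)

Section Divisors.
Local Open Scope nat_scope.

Lemma leq_expl m n e : m <= n -> m ^ e <= n ^ e.
Proof. by case: e => // e mn; rewrite leq_exp2r. Qed.

(** The map [f] is injective because the product of its components is [d]; it sends divisors of
    [a * b] to pairs of divisors of [a] and [b]. *)
Lemma size_divisorsM a b : 0 < a -> 0 < b ->
  size (divisors (a * b)) <= size (divisors a) * size (divisors b).
Proof.
move=> a0 b0; pose f d := (gcdn d a, d %/ gcdn d a).
have fK d : (f d).1 * (f d).2 = d by rewrite mulnC divnK // dvdn_gcdl.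
rewrite -(size_map f) -(size_allpairs pair); apply: uniq_leq_size.
  rewrite map_inj_in_uniq ?divisors_uniq // => d1 d2 _ _ ed.
  by rewrite -[d1]fK -[d2]fK ed.
move=> _ /mapP [d + ->]; rewrite -dvdn_divisors ?muln_gt0 ?a0 // => dab.
apply/allpairsP; exists (f d); split=> //=.
  by rewrite -dvdn_divisors // dvdn_gcdr.
rewrite -dvdn_divisors //.
have g0 : 0 < gcdn d a by rewrite gcdn_gt0 a0 orbT.
have cop : coprime (d %/ gcdn d a) (a %/ gcdn d a).
  rewrite /coprime -(eqn_pmul2r g0) mul1n muln_gcdl !divnK //.
    exact: dvdn_gcdr.
  exact: dvdn_gcdl.
rewrite -(Gauss_dvdr _ cop) -(dvdn_pmul2r g0) divnK ?dvdn_gcdl //.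
by rewrite mulnAC divnK ?dvdn_gcdr.
Qed.

Lemma size_divisors_pfactor q a : prime q -> size (divisors (q ^ a)) <= a.+1.
Proof.
move=> pq; rewrite -[leqRHS](size_iota 0) -[leqRHS](size_map (expn q)).
apply: uniq_leq_size (divisors_uniq _) _ => d.
rewrite -dvdn_divisors ?expn_gt0 ?prime_gt0 // => /(dvdn_pfactor _ _ pq) [m ma ->].
by apply: map_f; rewrite mem_iota.
Qed.

(** With the quotient rounded down, [a + 1 <= m * (a / m + 1) <= m * 2 ^ (a / m)]; raise this to the
    power [m]. *)
Lemma exp_succ_le m a : 0 < m -> a.+1 ^ m <= m ^ m * 2 ^ a.
Proof.
move=> m0; apply: (@leq_trans ((m * 2 ^ (a %/ m)) ^ m)).
  rewrite leq_exp2r //; apply: (@leq_trans (m * (a %/ m).+1)).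
    by rewrite mulnC ltn_ceil.
  by rewrite leq_mul2l ltn_expl ?orbT.
by rewrite expnMn -expnM leq_mul2l leq_exp2l // leq_divM orbT.
Qed.

(** A prime [q < 2 ^ m] costs a factor [m ^ m]. A larger one costs nothing, since
    [(l + 1) ^ m <= 2 ^ (l * m) <= q ^ l]. *)
Lemma size_divisors_prod (m : nat) (l : nat -> nat) (s : seq nat) :
  0 < m -> {in s, forall q, prime q} ->
  size (divisors (\prod_(q <- s) q ^ l q)) ^ m <=
  (m ^ m) ^ count (fun q => q < 2 ^ m) s * \prod_(q <- s) q ^ l q.
Proof.
move=> m0; elim: s => [|q s IHs] ps.
  by rewrite big_nil muln1 exp1n.
have pq : prime q by apply: ps; rewrite mem_head.
have {}ps : {in s, forall q, prime q} by move=> r rs; apply: ps; rewrite inE rs orbT.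
rewrite big_cons /=.
have q_gt0 : 0 < q ^ l q by rewrite expn_gt0 prime_gt0.
have s_gt0 : 0 < \prod_(q <- s) q ^ l q.
  rewrite big_seq; apply: prodn_cond_gt0 => r rs.
  by rewrite expn_gt0 prime_gt0 // ps.
have le1 : size (divisors (q ^ l q * \prod_(q <- s) q ^ l q)) ^ m <=
  (l q).+1 ^ m * size (divisors (\prod_(q <- s) q ^ l q)) ^ m.
  rewrite -expnMn leq_exp2r //; apply: leq_trans (size_divisorsM q_gt0 s_gt0) _.
  by rewrite leq_mul2r size_divisors_pfactor ?orbT.
apply: leq_trans le1 _.
rewrite expnD mulnACA leq_mul ?IHs //.
case: ltnP => [_|q_ge].
  rewrite expn1; apply: leq_trans (exp_succ_le _ m0) _.
  by rewrite leq_mul2l leq_expl ?orbT // prime_gt1.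
rewrite mul1n; apply: (@leq_trans ((2 ^ l q) ^ m)).
  by rewrite leq_exp2r // ltn_expl.
by rewrite -expnM mulnC expnM leq_expl.
Qed.

(** Fewer than [2 ^ m] primes lie below [2 ^ m], so the total loss depends on [m] alone. *)
Lemma divisor_bound (m n : nat) : 0 < m -> 0 < n ->
  size (divisors n) ^ m <= (m ^ m) ^ (2 ^ m) * n.
Proof.
move=> m0 n0.
have nE : n = \prod_(q <- primes n) q ^ logn q n.
  by rewrite [LHS]prod_prime_decomp // prime_decompE big_map.
have := @size_divisors_prod m (logn^~ n) (primes n) m0.
rewrite -nE => H.
apply: leq_trans (H _) _; first by move=> q; rewrite mem_primes => /andP [].
rewrite leq_mul2r; apply/orP; right; apply: leq_pexp2l; first by rewrite expn_gt0 m0.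
rewrite -size_filter -[leqRHS](size_iota 0).
apply: uniq_leq_size; first by rewrite filter_uniq // primes_uniq.
by move=> q; rewrite mem_filter mem_iota add0n => /andP [].
Qed.

End Divisors.

(** * Repeated tuples and roots of sums of reciprocals *)

(* A function all of whose fibres have at least two points has an image of at
   most [#|J| / 2] points. *)
Lemma card_paired_le (J : finType) (k T : nat) : (0 < k)%N -> (0 < T)%N ->
  #|J| = (2 * k)%N ->
  (#|[set v : {ffun J -> 'I_T} | [forall j, exists j', (j' != j) && (v j' == v j)]]|
     <= k ^ (2 * k) * T ^ k)%N.
Proof.
move=> k0 T0 cardJ.
pose comp (h : {ffun J -> 'I_k} * {ffun 'I_k -> 'I_T}) : {ffun J -> 'I_T} :=
  [ffun j => h.2 (h.1 j)].
have -> : (k ^ (2 * k) * T ^ k =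
    #|{: {ffun J -> 'I_k} * {ffun 'I_k -> 'I_T}}|)%N.
  by rewrite card_prod !card_ffun !card_ord cardJ.
apply: leq_trans (leq_imset_card comp predT).
apply: subset_leq_card; apply/subsetP => v; rewrite inE => /forallP vP.
pose im := [set v j | j in predT].
(* Each fibre over [im] has at least two of the [2 * k] points. *)
have im_le : (#|im| <= k)%N.
  rewrite -(leq_pmul2l (ltn0Sn 1)) -cardJ -[#|J|]sum1_card.
  rewrite (partition_big_imset v) /= mulnC -sum_nat_const.
  apply: leq_sum => t /imsetP [j _ ->].
  have /existsP [j' /andP [j'j vj']] := vP j.
  rewrite (bigD1 j) //= (bigD1 j') /= ?vj' //; lia.
(* [h1] numbers the values of [v] and [h2] lists them. The default in [h1] is never reached, by
   [im_le]; the one in [h2] only fills positions beyond the list. *)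
pose h1 : {ffun J -> 'I_k} :=
  [ffun j => insubd (Ordinal k0) (index (v j) (enum im))].
pose h2 : {ffun 'I_k -> 'I_T} := [ffun i : 'I_k => nth (Ordinal T0) (enum im) i].
apply/imsetP; exists (h1, h2) => //; apply/ffunP => j; rewrite !ffunE /=.
have vim : v j \in enum im by rewrite mem_enum; apply: imset_f.
rewrite insubdK ?nth_index //.
by apply: leq_trans im_le; rewrite cardE index_mem.
Qed.

(** Clearing denominators turns the equation into a polynomial [P] of degree less than [#|J|]. *)
Lemma card_roots_signed_inv_sum_le (F : fieldType) (J : finType) (s t : J -> F)
    (j0 : J) (S : seq F) :
  uniq S -> s j0 != 0 -> (forall j, j != j0 -> t j != t j0) ->
  (forall y, y \in S ->
     (forall j, y + t j != 0) /\ \sum_j s j / (y + t j) = 0) ->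
  (size S <= #|J|)%N.
Proof.
move=> uS s0 tj0 SP.
pose f j : {poly F} := 'X + (t j)%:P.
pose P : {poly F} := \sum_j (s j)%:P * \prod_(j' | j' != j) f j'.
have fE j y : (f j).[y] = y + t j by rewrite /f !hornerE.
have PE y : P.[y] = \sum_j s j * \prod_(j' | j' != j) (y + t j').
  rewrite /P horner_sum; apply: eq_bigr => j _.
  by rewrite hornerM hornerC horner_prod; under eq_bigr do rewrite fE.
(* At [- t j0] only the term [j0] survives, and it is nonzero because the value [t j0] is not
   repeated. *)
have P_neq0 : P != 0.
  apply/eqP => P0; have := PE (- t j0); rewrite P0 horner0 => /esym/eqP.
  rewrite (bigD1 j0) //= [X in _ + X]big1 ?addr0 => [|j jj0].
    rewrite mulf_eq0 (negPf s0) /= => /prodf_eq0 [j /tj0].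
    by rewrite addrC subr_eq0 => /negPf ->.
  by rewrite (bigD1 j0) 1?eq_sym //= addNr mul0r mulr0.
have P_size : (size P <= #|J|)%N.
  apply: leq_trans (size_sum _ _ _) _; apply/bigmax_leqP => j _.
  rewrite mul_polyC; apply: leq_trans (size_scale_leq _ _) _.
  apply: leq_trans (size_prod_leq _ _) _.
  under eq_bigr do rewrite size_XaddC.
  rewrite sum_nat_const.
  have J0 : (0 < #|J|)%N by apply/card_gt0P; exists j.
  have -> : #|(fun i : J => i != j)| = #|J|.-1 by rewrite -(cardC1 j).
  by rewrite -[2%R]/2%N; lia.
apply: leq_trans P_size; apply/ltnW.
apply: max_poly_roots => //; apply/allP => y /SP [yt ys]; apply/rootP.
rewrite PE.
transitivity ((\prod_j (y + t j)) * \sum_j s j / (y + t j)); last by rewrite ys mulr0.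
rewrite mulr_sumr; apply: eq_bigr => j _.
rewrite [in RHS](bigD1 j) //=; set Q := \prod_(_ | _) _.
by field; apply: yt.
Qed.

(** * Reciprocals of an interval *)

Definition pt (p : nat) (M : int) (i : nat) : 'F_p := (M + i.+1%:Z)%:~R.

(** The distance to the nearest multiple of [p]: it recovers [|w|] from the class of an integer [w]
    with [2 |w| < p]. *)
Definition absmod (p : nat) (x : 'F_p) : nat := minn x (p - x).
Arguments absmod p x%_R.

Lemma absmod_int (p : nat) (w : int) : prime p -> (2 * `|w| < p)%N ->
  absmod (w%:~R : 'F_p) = `|w|%N.
Proof.
move=> pr_p; rewrite /absmod; case: (intP w) => [|n|n] wp.
- by rewrite min0n.
- rewrite -pmulrn val_Fp_nat // modn_small; last by move: wp => /=; lia.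
  by move: wp => /=; lia.
- have np : (n.+1 < p)%N by move: wp; rewrite abszN absz_nat; lia.
  have -> : (- n.+1%:Z)%:~R = (p - n.+1)%:R :> 'F_p.
    apply/eqP; rewrite rmorphN /= -pmulrn eq_sym -subr_eq0 opprK -natrD subnK; last exact: ltnW.
    by rewrite pchar_Fp_0.
  rewrite val_Fp_nat // modn_small; last by lia.
  by move: wp; rewrite abszN absz_nat; lia.
Qed.

Lemma Fp_nat_inj (p m n : nat) : prime p -> (m < p)%N -> (n < p)%N ->
  (m%:R == n%:R :> 'F_p) = (m == n).
Proof.
by move=> pr_p mp np; rewrite -val_eqE /= !val_Fp_nat // !modn_small.
Qed.

Lemma Fp_nat_neq0 (p n : nat) : prime p -> (0 < n < p)%N -> n%:R != 0 :> 'F_p.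
Proof.
move=> pr_p /andP [n0 np].
by rewrite -[0]/(0%:R) Fp_nat_inj ?prime_gt0 // -lt0n.
Qed.

Lemma absmod_gt0 (p : nat) (x : 'F_p) : prime p -> x != 0 -> (0 < absmod x)%N.
Proof.
move=> pr_p x0; rewrite /absmod leq_min lt0n subn_gt0.
have -> : (x < p)%N by rewrite -[X in (_ < X)%N](Fp_cast pr_p) ltn_ord.
by rewrite andbT; apply: contra x0 => /eqP xE; apply/eqP/val_inj.
Qed.

Lemma leq_absD (d : int) (n : nat) : (`|(d + n%:Z)%R| <= `|d| + n)%N.
Proof. lia. Qed.

Lemma absz_subn_mul_le (a b h n : nat) :
  ((a - b) * h <= n)%N -> ((b - a) * h <= n)%N -> (`|(a%:Z - b%:Z)%R| * h <= n)%N.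
Proof.
have [ba|/ltnW ab] := leqP b a.
  by have -> : `|(a%:Z - b%:Z)%R|%N = (a - b)%N by lia.
by have -> : `|(a%:Z - b%:Z)%R|%N = (b - a)%N by lia.
Qed.

Lemma card_ord_pos_le (n m : nat) : (#|[pred e : 'I_n | 0 < e <= m]| <= m)%N.
Proof.
rewrite cardE -(size_map val) -[leqRHS](size_iota 1).
apply: uniq_leq_size; first by rewrite map_inj_uniq ?enum_uniq //; apply: val_inj.
move=> _ /mapP [e + ->]; rewrite mem_enum inE mem_iota => /andP [e0 em] /=.
by rewrite e0 ltnS.
Qed.

(** * Amplification by the shifts [x = x' + t u] *)

Section Amplification.
Variables (p : nat) (M : int) (N U T H : nat).
Hypotheses (pr_p : prime p) (N_le_p : (N <= p)%N).
Hypotheses (U_gt0 : (0 < U)%N) (T_gt0 : (0 < T)%N) (UT_le : (U * T <= N)%N).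
Hypotheses (NU_le : (N * U <= p)%N) (H_ge7 : (7 <= H)%N).
Hypothesis H_div : forall n, (0 < n <= N ^ 2)%N -> (2 * size (divisors n) <= H)%N.
Hypothesis pt_neq0 : forall i, (i < N)%N -> pt p M i != 0.

Let N_gt0 : (0 < N)%N. Proof. nia. Qed.
Let U_le_N : (U <= N)%N. Proof. nia. Qed.
Let T_le_N : (T <= N)%N. Proof. nia. Qed.
Let U_lt_p : (U < p)%N.
Proof. by have := prime_gt1 pr_p; nia. Qed.

(* Two pairs [(x', u)] with the same quotient [x' / u] and close to each other
   make some [u] bad for [x = x' + t u]. *)
Definition bad (i u : nat) : bool :=
  [exists e : 'I_U.+1,
     [&& (0 < e)%N, (e * H <= U)%N,
         (absmod (pt p M i * e%:R) * H <= 3 * N * U)%N &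
         (u %| absmod (pt p M i * e%:R))%N]].

(** For each of the at most [U / H] values of [e], a bad [u] divides the fixed number [m e], which
    lies between 1 and [N ^ 2] and so has at most [H / 2] divisors. *)
Lemma card_bad_le (i : nat) : (i < N)%N ->
  (2 * #|[set u : 'I_U | bad i u.+1]| <= U)%N.
Proof.
move=> iN.
pose m (e : 'I_U.+1) := absmod (pt p M i * e%:R).
pose P := [pred e : 'I_U.+1 | (0 < e <= U %/ H)%N && (m e * H <= 3 * N * U)%N].
have PE e : P e = [&& (0 < e)%N, (e * H <= U)%N & (m e * H <= 3 * N * U)%N].
  by rewrite /P /= leq_divRL -?andbA //; lia.
have le1 : (#|[set u : 'I_U | bad i u.+1]| <= \sum_(e | P e) size (divisors (m e)))%N.
  apply: (@leq_trans #|\bigcup_(e | P e) [set u : 'I_U | u.+1 \in divisors (m e)]|).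
    apply: subset_leq_card; apply/subsetP => u; rewrite inE => /existsP [e].
    rewrite andbA andbA => /andP [Pe ue]; apply/bigcupP; exists e.
      by rewrite PE andbA.
    rewrite inE -dvdn_divisors //; apply: absmod_gt0 => //.
    rewrite mulf_neq0 ?pt_neq0 ?Fp_nat_neq0 //.
    by move: Pe => /andP [/andP [-> _] _] /=; have := ltn_ord e; lia.
  apply: (@leq_trans (\sum_(e | P e) #|[set u : 'I_U | u.+1 \in divisors (m e)]|)).
    elim/big_rec2: _ => [|e n A _ IHA]; first by rewrite cards0.
    by apply: leq_trans (leq_card_setU _ _) _; rewrite leq_add2l.
  apply: leq_sum => e _; rewrite cardE -(size_map (fun u : 'I_U => u.+1)).
  apply: uniq_leq_size.
    by rewrite map_inj_uniq ?enum_uniq // => u v [] /val_inj.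
  by move=> _ /mapP [u + ->]; rewrite mem_enum inE.
have le2 : (2 * (\sum_(e | P e) size (divisors (m e))) <= \sum_(e | P e) H)%N.
  rewrite big_distrr /=; apply: leq_sum => e Pe.
  have /and3P [e0 eU meH] : [&& (0 < e)%N, (e * H <= U)%N & (m e * H <= 3 * N * U)%N].
    by rewrite -PE.
  apply: H_div; rewrite absmod_gt0 //=.
    by have := U_le_N; nia.
  rewrite mulf_neq0 ?pt_neq0 ?Fp_nat_neq0 // e0 /=.
  by have := ltn_ord e; lia.
rewrite sum_nat_const in le2.
have le3 : (#|P| <= U %/ H)%N.
  apply: leq_trans (card_ord_pos_le U.+1 (U %/ H)).
  by apply: subset_leq_card; apply/subsetP => e /andP [].
apply: (@leq_trans (2 * \sum_(e | P e) size (divisors (m e)))).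
  by rewrite leq_mul2l le1 orbT.
apply: leq_trans le2 _; apply: leq_trans (leq_trunc_div U H).
by rewrite leq_mul2r le3 orbT.
Qed.

(* The pair [q] stands for [(x', u)] with [x' = M + 1 + q.1 - N] and
   [u = q.2 + 1]; the points [pt i] of the interval are indexed from [i = 0]. *)
Definition base (q : 'I_(2 * N) * 'I_U) : 'F_p :=
  (M + (q.1 : nat).+1%:Z - N%:Z)%:~R.

(** The offset [N] keeps indices natural. As [t u <= N], the [2 * N] values of [q.1] contain
    [x' = x - t u] for every [x] in the interval. *)
Definition act (q : 'I_(2 * N) * 'I_U) (t : 'I_T) : bool :=
  (N <= q.1 + t * q.2.+1 < 2 * N)%N && ~~ bad (q.1 + t * q.2.+1 - N) q.2.+1.

Lemma base_shift (q : 'I_(2 * N) * 'I_U) (s : nat) : (N <= q.1 + s)%N ->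
  base q + s%:R = pt p M (q.1 + s - N).
Proof.
move=> Ns; rewrite /base /pt pmulrn -rmorphD /=; congr (_ %:~R); lia.
Qed.

Lemma box_dist (a b L : nat) : (0 < L)%N -> (a %/ L = b %/ L)%N -> (a - b < L)%N.
Proof.
move=> L0 ab; have := divn_eq a L; have := divn_eq b L; rewrite ab.
by have := ltn_pmod a L0; lia.
Qed.

(** Boxes of this length are short enough to keep their points within [n / H], yet at most [H] of
    them cover the numbers below [n]. *)
Lemma box_dist_mul (a b n : nat) :
  (a %/ (n %/ H).+1 = b %/ (n %/ H).+1)%N -> ((a - b) * H <= n)%N.
Proof.
move=> ab; have := box_dist (ltn0Sn (n %/ H)) ab; rewrite ltnS => le1.
by apply: leq_trans (leq_trunc_div n H); rewrite leq_mul2r le1 orbT.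
Qed.

Lemma succ_neq0 (u : 'I_U) : u.+1%:R != 0 :> 'F_p.
Proof. by apply: Fp_nat_neq0 => //=; apply: leq_ltn_trans U_lt_p. Qed.

(** With [x'_1 u_2 = x'_2 u_1] and [e = u_1 - u_2], one gets [(x'_1 + t u_1) e = u_1 (x'_1 - x'_2 +
    t e)]: a small integer divisible by [u_1]. *)
Lemma collision_bad (q1 q2 : 'I_(2 * N) * 'I_U) (t : 'I_T) :
  (q2.2 < q1.2)%N ->
  ((q1.1 - q2.1) * H <= 2 * N)%N -> ((q2.1 - q1.1) * H <= 2 * N)%N ->
  ((q1.2 - q2.2) * H <= U)%N ->
  base q1 * q2.2.+1%:R = base q2 * q1.2.+1%:R ->
  (N <= q1.1 + t * q1.2.+1)%N ->
  bad (q1.1 + t * q1.2.+1 - N) q1.2.+1.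
Proof.
move=> lt21 lez lez' leu yE actN.
pose e := (q1.2 - q2.2)%N.
have eE : q1.2.+1%:R - q2.2.+1%:R = e%:R :> 'F_p by rewrite -natrB // ltnW.
pose d : int := (q1.1 : nat)%:Z - (q2.1 : nat)%:Z.
have dE : base q1 - base q2 = d%:~R.
  by rewrite /base -rmorphB /=; congr (_ %:~R); rewrite /d; lia.
pose w : int := (d + (t * e)%N%:Z) * q1.2.+1%:Z.
have wE : pt p M (q1.1 + t * q1.2.+1 - N) * e%:R = w%:~R.
  rewrite -(base_shift actN) /w intrM intrD -dE -!pmulrn !natrM -eE.
  rewrite mulrDl [base q1 * _]mulrBr yE; ring.
have e_gt0 : (0 < e)%N by rewrite subn_gt0.
have tT := ltn_ord t; have uU := ltn_ord q1.2.
have wH : (`|w| * H <= 3 * N * U)%N.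
  have dH : (`|d| * H <= 2 * N)%N.
    exact: absz_subn_mul_le.
  have teH : (t * e * H <= N)%N.
    by rewrite -mulnA; apply: leq_trans UT_le; rewrite mulnC leq_mul // ltnW.
  have sH : (`|(d + (t * e)%N%:Z)%R| * H <= 3 * N)%N.
    apply: (@leq_trans ((`|d| + t * e) * H)%N).
      by rewrite leq_mul2r; apply/orP; right; apply: leq_absD.
    by rewrite mulnDl -[3%N]/(2 + 1)%N mulnDl mul1n leq_add.
  rewrite /w abszM absz_nat mulnAC; apply: leq_mul => //.
(* From [H >= 7] and [N U <= p], [2 |w| <= 6 p / 7], so no wraparound occurs modulo [p]. *)
have w_small : (2 * `|w| < p)%N.
  have : (7 * `|w| <= 3 * p)%N.
    apply: leq_trans (leq_mul H_ge7 (leqnn _)) _; rewrite mulnC.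
    by apply: leq_trans wH _; rewrite -mulnA leq_mul2l.
  by have := prime_gt0 pr_p; clear; lia.
apply/existsP.
have eU : (e < U.+1)%N by rewrite /e; lia.
exists (Ordinal eU); rewrite /= wE absmod_int // e_gt0 wH leu /=.
by rewrite /w abszM dvdn_mull.
Qed.

(** If the two [u] differ, the larger one is bad, against activity. If they agree, the two [x'] are
    congruent and too close to be distinct. *)
Lemma collision_eq (q1 q2 : 'I_(2 * N) * 'I_U) (t1 t2 : 'I_T) :
  (q1.1 %/ (2 * N %/ H).+1 = q2.1 %/ (2 * N %/ H).+1)%N ->
  (q1.2 %/ (U %/ H).+1 = q2.2 %/ (U %/ H).+1)%N ->
  base q1 / q1.2.+1%:R = base q2 / q2.2.+1%:R ->
  act q1 t1 -> act q2 t2 -> q1 = q2.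
Proof.
move=> bz bu yE /andP [/andP [N1 _] nb1] /andP [/andP [N2 _] nb2].
have yE' : base q1 * q2.2.+1%:R = base q2 * q1.2.+1%:R.
  by apply/eqP; rewrite -eqr_div ?succ_neq0 // yE.
have lez := box_dist_mul bz; have lez' := box_dist_mul (esym bz).
have leu := box_dist_mul bu; have leu' := box_dist_mul (esym bu).
case: (ltngtP q1.2 q2.2) => [lt12|lt21|eu].
- by rewrite (collision_bad lt12 lez' lez leu' (esym yE') N2) in nb2.
- by rewrite (collision_bad lt21 lez lez' leu yE' N1) in nb1.
move: yE'; rewrite eu => /(mulIf (succ_neq0 q2.2)) bE.
have p0 := prime_gt0 pr_p.
case: q1 q2 eu bE lez lez' {bz bu yE nb1 nb2 N1 N2 leu leu'} => [z1 u1] [z2 u2] /= eu bE lez lez'.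
congr pair; last exact: val_inj.
apply: val_inj => /=; apply/eqP.
have zE : (z1%:R : 'F_p) == z2%:R.
  move/eqP: bE; rewrite /base /= -subr_eq0 -rmorphB /= => bE.
  rewrite -subr_eq0; move: bE; congr (_ == 0).
  by rewrite !pmulrn -rmorphB /=; congr (_ %:~R); lia.
wlog z21 : z1 z2 lez lez' zE {bE} / (z2 <= z1)%N.
  move=> Hw; case: (leqP z2 z1) => [|/ltnW] z21; first exact: Hw.
  by rewrite eq_sym; apply: Hw => //; rewrite eq_sym.
move: zE; rewrite -subr_eq0 -natrB //.
have [|zn] := eqVneq (nat_of_ord z1) z2; first by [].
move=> z0; rewrite -(negPf (Fp_nat_neq0 (n := z1 - z2) pr_p _)) //.
have : (7 * (z1 - z2) <= 2 * p)%N.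
  apply: leq_trans (leq_mul H_ge7 (leqnn _)) _; rewrite mulnC.
  by apply: leq_trans lez _; rewrite leq_mul2l.
by move: (prime_gt0 pr_p) zn z21; clear; lia.
Qed.

Let H_gt0 : (0 < H)%N. Proof. lia. Qed.

Let sol (k : nat) (v : {ffun bool * 'I_k -> 'I_T}) :=
  [set q : 'I_(2 * N) * 'I_U | [forall j, act q (v j)] &&
     (signed_sum (fun t : 'I_T => (base q + (t * q.2.+1)%:R)^-1) v == 0)].

(** Pigeonhole: there are at most [H ^ 2] boxes, and by [collision_eq] each contains at most one
    element of [S]. *)
Lemma card_box_le (S : {set 'I_(2 * N) * 'I_U}) (y : 'F_p) :
  (forall q, q \in S -> exists t, act q t) ->
  (forall q, q \in S -> base q / q.2.+1%:R = y) -> (#|S| <= H ^ 2)%N.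
Proof.
move=> Sact Sy.
pose box n a := insubd (Ordinal H_gt0) (a %/ (n %/ H).+1)%N.
have boxK n a b : (a < n)%N -> (b < n)%N -> box n a = box n b ->
    (a %/ (n %/ H).+1 = b %/ (n %/ H).+1)%N.
  have lt c : (c < n)%N -> (c %/ (n %/ H).+1 < H)%N.
    move=> cn; rewrite ltn_divLR //; apply: leq_trans cn _.
    by rewrite mulnC ltnW // ltn_ceil.
  by move=> an bn /(congr1 val); rewrite /box !insubdK //; apply: lt.
pose f (q : 'I_(2 * N) * 'I_U) := (box (2 * N)%N q.1, box U q.2).
have f_inj : {in S &, injective f}.
  move=> q1 q2 S1 S2 [/boxK bz /boxK bu].
  have [t1 a1] := Sact _ S1; have [t2 a2] := Sact _ S2.
  by apply: (collision_eq _ _ _ a1 a2); rewrite ?bz ?bu ?Sy.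
rewrite -(card_in_imset f_inj); apply: leq_trans (max_card _) _.
by rewrite card_prod !card_ord mulnn.
Qed.

(** Since [x' + t u = u (y + t)] with [y = x' / u], the equation involves [y] alone. It has at most
    [2 * k] roots, each coming from at most [H ^ 2] pairs. *)
Lemma card_sol_le (k : nat) (v : {ffun bool * 'I_k -> 'I_T}) j0 :
  (forall j, j != j0 -> v j != v j0) -> (#|sol v| <= 2 * k * H ^ 2)%N.
Proof.
move=> vj0.
pose y (q : 'I_(2 * N) * 'I_U) : 'F_p := base q / q.2.+1%:R.
have u0 (q : 'I_(2 * N) * 'I_U) : q.2.+1%:R != 0 :> 'F_p by apply: succ_neq0.
have yE q t : base q + (t * q.2.+1)%:R = q.2.+1%:R * (y q + t%:R).
  by rewrite /y mulrDr mulrCA mulfV // mulr1 natrM [X in _ + X]mulrC.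
rewrite -sum1_card (partition_big_imset y) /=.
apply: (@leq_trans (\sum_(z in [set y q | q in sol v]) H ^ 2)).
  apply: leq_sum => z _; rewrite sum1_card.
  rewrite -(cardsE [pred q in sol v | y q == z]).
  apply: (@card_box_le _ z) => q; rewrite !inE => /andP [/andP [/forallP qa _] /eqP //].
  by exists (v j0); apply: qa.
rewrite sum_nat_const leq_mul2r; apply/orP; right.
have -> : (2 * k = #|{: bool * 'I_k}|)%N by rewrite card_prod card_bool card_ord.
rewrite cardE; apply: (@card_roots_signed_inv_sum_le _ _
  (fun j : bool * 'I_k => (-1) ^+ j.1) (fun j => (v j : nat)%:R) j0).
- exact: enum_uniq.
- by rewrite signr_eq0.
- move=> j /vj0; have := ltn_ord (v j); have := ltn_ord (v j0) => l0 l1.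
  by rewrite Fp_nat_inj ?(leq_trans l0) ?(leq_trans l1) // (leq_trans T_le_N).
move=> z; rewrite mem_enum => /imsetP [q]; rewrite inE => /andP [/forallP qa /eqP qs] ->.
(* Active shifts land in the interval, which avoids 0, so no denominator vanishes. *)
have nz j : y q + (v j)%:R != 0.
  have /andP [/andP [Na Nb] _] := qa j.
  have iN : (q.1 + v j * q.2.+1 - N < N)%N by rewrite ltn_subLR // addnn -mul2n.
  have := pt_neq0 iN.
  by rewrite -base_shift // yE mulf_eq0 negb_or => /andP [].
split=> //; apply: (mulfI (invr_neq0 (u0 q))); rewrite mulr0 -[RHS]qs mulr_sumr.
by apply: eq_bigr => j _; rewrite yE invfM mulrCA.
Qed.

(** Fix the shifts [v] first. For the few [v] with all values repeated, every pair [q] is allowed;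
    for the others [card_sol_le] applies. *)
Lemma sum_energy_le (k : nat) : (0 < k)%N ->
  (\sum_q energy k (act q : 'I_T -> nat)
       (fun t : 'I_T => (base q + (t * q.2.+1)%:R)^-1) <=
   k ^ (2 * k) * T ^ k * (2 * N * U) + T ^ (2 * k) * (2 * k * H ^ 2))%N.
Proof.
move=> k0.
have prodE (I : finType) (b : pred I) : (\prod_i b i = [forall i, b i])%N.
  case: forallP => [bT|/forallP]; first by rewrite big1 // => i _; rewrite bT.
  by rewrite negb_forall => /existsP [i /negPf bi]; rewrite (bigD1 i) //= bi.
have -> : (\sum_q energy k (act q : 'I_T -> nat)
    (fun t : 'I_T => (base q + (t * q.2.+1)%:R)^-1) =
    \sum_(v : {ffun bool * 'I_k -> 'I_T}) #|sol v|)%N.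
  under eq_bigr do rewrite /energy big_mkcond /=.
  rewrite exchange_big; apply: eq_bigr => v _ /=.
  rewrite -sum1_card [RHS]big_mkcond; apply: eq_bigr => q _ /=.
  rewrite inE (prodE _ (fun j => act q (v j))) andbC.
  by case: eqP => //= _; case: [forall j, _].
pose paired := [set v : {ffun bool * 'I_k -> 'I_T} |
  [forall j, exists j', (j' != j) && (v j' == v j)]].
have cardJ : #|{: bool * 'I_k}| = (2 * k)%N by rewrite card_prod card_bool card_ord.
rewrite (bigID (mem paired)) /=; apply: leq_add.
  apply: (@leq_trans (\sum_(v in paired) 2 * N * U)).
    apply: leq_sum => v _; apply: leq_trans (max_card _) _.
    by rewrite card_prod !card_ord.
  rewrite sum_nat_const leq_mul2r; apply/orP; right.
  exact: card_paired_le.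
apply: (@leq_trans (\sum_(v | v \notin paired) 2 * k * H ^ 2)).
  apply: leq_sum => v; rewrite inE negb_forall => /existsP [j0].
  rewrite negb_exists => /forallP vj0; apply: (@card_sol_le _ _ j0) => j jj0.
  by have := vj0 j; rewrite jj0.
rewrite sum_nat_const leq_mul2r; apply/orP; right.
apply: leq_trans (max_card _) _.
by rewrite card_ffun cardJ card_ord.
Qed.

Let good (i : nat) := [set u : 'I_U | ~~ bad i u.+1].

(** The admissible [z] run from [N - s] to [2 * N - s - 1], a full translate of the interval because
    [s <= N]. *)
Lemma sum_shift {V : nmodType} (s : nat) (f : nat -> V) : (s <= N)%N ->
  \sum_(z < 2 * N | (N <= z + s < 2 * N)%N) f (z + s - N)%N = \sum_(i < N) f i.
Proof.
move=> sN.
rewrite -(big_mkord (fun z => (N <= z + s < 2 * N)%N) (fun z => f (z + s - N)%N)).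
rewrite -(big_mkord xpredT f).
rewrite (big_cat_nat (n := N - s)) //=; last by lia.
rewrite big_nat_cond big_pred0 ?add0r => [|z]; last by lia.
rewrite (big_cat_nat (n := N - s + N)) //=; [|by lia|by lia].
rewrite [X in _ + X]big_nat_cond [X in _ + X]big_pred0 ?addr0 => [|z]; last by lia.
rewrite -[X in \sum_(X <= _ < _ | _) _]add0n big_addn addKn.
rewrite big_nat_cond [RHS]big_nat_cond.
apply: eq_big => [i|i]; first by lia.
by move=> _; congr f; lia.
Qed.

(** For fixed [t] and [u] the shift is a bijection onto the interval, and badness depends only on
    [x] and [u]; so [x] is hit [T] times for each good [u]. This is the splitting needed by
    [energy_Hoelder]. *)
Lemma amplify {C : numClosedFieldType} (phi : 'F_p -> C) :
  \sum_(i < N) (#|good i| * T)%:R * phi (pt p M i)^-1 =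
  \sum_q \sum_(t < T) (act q t)%:R * phi (base q + (t * q.2.+1)%:R)^-1.
Proof.
rewrite -(pair_bigA _ (fun z u => \sum_(t < T) (act (z, u) t)%:R *
  phi (base (z, u) + (t * u.+1)%:R)^-1)) /=.
rewrite exchange_big /=.
under [RHS]eq_bigr => u _.
  rewrite exchange_big /=.
  under eq_bigr => t _.
    have -> : \sum_(z < 2 * N) (act (z, u) t)%:R * phi (base (z, u) + (t * u.+1)%:R)^-1
      = \sum_(z < 2 * N | (N <= z + t * u.+1 < 2 * N)%N)
         (~~ bad (z + t * u.+1 - N) u.+1)%:R * phi (pt p M (z + t * u.+1 - N))^-1.
      rewrite [RHS]big_mkcond; apply: eq_bigr => z _; rewrite /act /=.
      case: ifP => [/andP [Nz _]|_]; last by rewrite mul0r.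
      by rewrite base_shift.
    rewrite (@sum_shift _ _ (fun i => (~~ bad i u.+1)%:R * phi (pt p M i)^-1)).
  over.
    by have := ltn_ord t; have := ltn_ord u; nia.
  rewrite sumr_const card_ord -sumrMnl.
over.
rewrite exchange_big /=; apply: eq_bigr => i _.
rewrite sumrMnl -mulr_suml -natr_sum -mulrnAl natrM mulr_natr.
congr (_%:R *+ T * _); rewrite -sum1_card big_mkcond /=.
by apply: eq_bigr => u _; rewrite inE; case: (bad _ _).
Qed.


(** At least half of the [u] are good for each point, so every weight [c i] is at least [U * T / 2];
    this costs [2 ^ (2 * k)]. *)
Lemma energy_inv_pt_le {C : numClosedFieldType} (e : 'F_p -> C) (k : nat) :
  additive_char e -> (0 < k)%N ->
  ((U * T) ^ (2 * k) * energy k (fun=> 1%N) (fun i : 'I_N => (pt p M i)^-1) <=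
   2 ^ (2 * k) * ((2 * N * U) ^ (2 * k).-1 *
     (k ^ (2 * k) * T ^ k * (2 * N * U) + T ^ (2 * k) * (2 * k * H ^ 2))))%N.
Proof.
move=> e_char k0.
pose c (i : 'I_N) := (#|good i| * T)%N.
pose g (i : 'I_N) := (pt p M i)^-1.
have cardJ : #|{: bool * 'I_k}| = (2 * k)%N by rewrite card_prod card_bool card_ord.
have c_ge i : (U * T <= 2 * c i)%N.
  rewrite /c mulnA leq_mul2r; apply/orP; right.
  have -> : good i = ~: [set u : 'I_U | bad i u.+1].
    by apply/setP => u; rewrite !inE.
  have := cardsC [set u : 'I_U | bad i u.+1]; rewrite card_ord.
  have := card_bad_le (ltn_ord i); clear; lia.
apply: (@leq_trans (2 ^ (2 * k) * energy k c g)%N).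
  rewrite /energy !big_distrr /=; apply: leq_sum => v _.
  rewrite big1 // muln1 -cardJ -!prod_nat_const -big_split /=.
  by apply: leq_prod => j _; apply: c_ge.
rewrite leq_mul2l; apply/orP; right.
apply: leq_trans (energy_Hoelder pr_p e_char k0 amplify) _.
by rewrite card_prod !card_ord leq_mul2l sum_energy_le ?orbT.
Qed.

End Amplification.

(** * Choice of the parameters *)

Section Optimization.
Local Open Scope nat_scope.

(** Since [N U T <= N ^ 2 <= T ^ k.+1], the repeated tuples contribute no more than the order of the
    others. Powers of [T] are multiplied in so that [U T] can be compared with [N] without
    division. *)
Lemma energy_numeric_le (k N U T H J : nat) :
  0 < k -> 0 < N -> 0 < T -> 0 < H -> U * T <= N -> N <= 2 * (U * T) ->
  N ^ 2 <= T ^ k.+1 ->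
  (U * T) ^ (2 * k) * J <=
   2 ^ (2 * k) * ((2 * N * U) ^ (2 * k).-1 *
     (k ^ (2 * k) * T ^ k * (2 * N * U) + T ^ (2 * k) * (2 * k * H ^ 2))) ->
  J <= 2 ^ (6 * k) * (4 * k ^ (2 * k)) * (N ^ (2 * k.-1) * T * H ^ 2).
Proof.
move=> k0 N0 T0 H0 UT NUT NT main.
have k2E : 2 * k = (2 * k).-1.+1 by rewrite prednK // muln_gt0.
have H2 : 0 < H ^ 2 by rewrite expn_gt0 H0.
set A := (2 * N * U) ^ (2 * k).-1 in main.
set B := k ^ (2 * k) * T ^ k * (2 * N * U) + T ^ (2 * k) * (2 * k * H ^ 2) in main.
have NUT2 : N * U * T <= N ^ 2 by rewrite -mulnA expnS expn1 leq_mul.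
have A_le : A * T ^ (2 * k).-1 <= 2 ^ (2 * k) * (N ^ 2) ^ (2 * k).-1.
  have le2 : 2 * N * U * T <= 2 * N ^ 2.
    by rewrite -[2 * N * U]mulnA -mulnA leq_mul2l NUT2.
  rewrite /A -expnMn; apply: leq_trans (leq_expl _ le2) _.
  by rewrite expnMn leq_mul2r leq_exp2l // leq_pred orbT.
have B_le : B * T <= 4 * k ^ (2 * k) * (T ^ (2 * k).+1 * H ^ 2).
  have k_le : k <= k ^ (2 * k) by rewrite -[leqLHS]expn1 leq_pexp2l // muln_gt0.
  rewrite /B mulnDl.
  have -> : k ^ (2 * k) * T ^ k * (2 * N * U) * T = 2 * k ^ (2 * k) * (T ^ k * (N * U * T)).
    ring.
  have -> : T ^ (2 * k) * (2 * k * H ^ 2) * T = 2 * k * (T ^ (2 * k).+1 * H ^ 2).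
    by rewrite (expnS T); ring.
  have b1 : T ^ k * (N * U * T) <= T ^ (2 * k).+1 * H ^ 2.
    apply: (@leq_trans (T ^ k * T ^ k.+1)).
      by rewrite leq_mul2l (leq_trans NUT2) ?orbT.
    rewrite -expnD; rewrite addnS addnn -mul2n.
    by rewrite leq_pmulr.
  apply: (@leq_trans (2 * k ^ (2 * k) * (T ^ (2 * k).+1 * H ^ 2)
      + 2 * k ^ (2 * k) * (T ^ (2 * k).+1 * H ^ 2))).
    by apply: leq_add; apply: leq_mul => //; rewrite leq_mul2l k_le.
  by rewrite -mulnDl -mulnDl.
rewrite -(@leq_pmul2l (N ^ (2 * k) * T ^ (2 * k))); last by rewrite muln_gt0 !expn_gt0 N0 T0.
apply: (@leq_trans (2 ^ (2 * k) * (U * T) ^ (2 * k) * T ^ (2 * k) * J)).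
  by rewrite -[in leqRHS]expnMn !leq_mul // leq_expl.
apply: (@leq_trans (2 ^ (2 * k) * T ^ (2 * k) * (2 ^ (2 * k) * (A * B)))).
  have -> : 2 ^ (2 * k) * (U * T) ^ (2 * k) * T ^ (2 * k) * J =
    2 ^ (2 * k) * T ^ (2 * k) * ((U * T) ^ (2 * k) * J).
    by ring.
  by rewrite leq_mul2l main orbT.
have -> : 2 ^ (2 * k) * T ^ (2 * k) * (2 ^ (2 * k) * (A * B)) =
   2 ^ (2 * k) * 2 ^ (2 * k) * ((A * T ^ (2 * k).-1) * (B * T)).
  have -> : T ^ (2 * k) = T ^ (2 * k).-1 * T by rewrite [in LHS]k2E expnSr.
  by ring.
apply: leq_trans (leq_mul (leqnn _) (leq_mul A_le B_le)) _.
have NE : (N ^ 2) ^ (2 * k).-1 = N ^ (2 * k) * N ^ (2 * k.-1).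
  by rewrite -expnM -expnD; congr (_ ^ _); move: k0; clear; lia.
have E6 : 2 ^ (6 * k) = 2 ^ (2 * k) * 2 ^ (2 * k) * 2 ^ (2 * k).
  by rewrite -!expnD; congr (_ ^ _); clear; lia.
by rewrite NE E6 (expnS T); apply: eq_leq; ring.
Qed.

(** [T] is the least integer with [N ^ 2 <= T ^ k.+1], and [U] is [N / T] rounded down. *)
Lemma numeric_params (k N p : nat) : 0 < k -> 0 < N -> N ^ (2 * k) < p ^ k.+1 ->
  exists T U, [/\ 0 < T, 0 < U, U * T <= N, N <= 2 * (U * T) & N * U <= p]
    /\ N ^ 2 <= T ^ k.+1 <= 2 ^ k.+1 * N ^ 2.
Proof.
move=> k0 N0 Np.
have exT : exists T, N ^ 2 <= T ^ k.+1 by exists N; rewrite leq_pexp2l.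
case: (ex_minnP exT) => T NT Tmin.
have T0 : 0 < T by case: T NT {Tmin} => //; rewrite exp0n // leqn0 expn_eq0; lia.
have TN : T <= N by apply: Tmin; rewrite leq_pexp2l.
have U0 : 0 < N %/ T by rewrite divn_gt0.
have UT : N %/ T * T <= N by apply: leq_trunc_div.
exists T, (N %/ T); split; first split=> //.
- have := ltn_ceil N T0; rewrite mulSn => /ltnW /leq_trans; apply.
  by rewrite mul2n -addnn leq_add2r leq_pmull.
(* The size restriction enters here: [(N U) ^ k.+1 * N ^ 2 <= (N U T) ^ k.+1 <= N ^ (2 * k.+1)],
   hence [(N U) ^ k.+1 <= N ^ (2 * k) < p ^ k.+1]. *)
- apply: ltnW; rewrite -(ltn_exp2r _ _ (ltn0Sn k)).
  apply: leq_ltn_trans Np.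
  have N2 : 0 < N ^ 2 by rewrite expn_gt0 N0.
  rewrite -(leq_pmul2r N2).
  apply: (@leq_trans ((N * (N %/ T)) ^ k.+1 * T ^ k.+1)); first by rewrite leq_mul2l NT orbT.
  rewrite -expnMn -expnD; apply: (@leq_trans ((N ^ 2) ^ k.+1)).
    by rewrite leq_exp2r // -mulnA expnS expn1 leq_mul.
  by rewrite -expnM; apply: eq_leq; congr (_ ^ _); lia.
rewrite NT /=; case: T T0 NT Tmin {TN U0 UT} => // T _ NT Tmin.
case: T NT Tmin => [|T] NT Tmin.
  by rewrite exp1n muln_gt0 !expn_gt0 N0.
(* Minimality is applied to the predecessor, which is at least half of the chosen value. *)
apply: (@leq_trans ((2 * T.+1) ^ k.+1)); first by rewrite leq_exp2r //; lia.
rewrite expnMn leq_mul2l; apply/orP; right.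
by case: (leqP (T.+1 ^ k.+1) (N ^ 2)) => // /ltnW /Tmin; rewrite ltnn.
Qed.

Definition max_tau (n : nat) : nat := \max_(i < n.+1) size (divisors i).

(** The divisor bound with exponent [2 * r] at numbers up to [N ^ 2], followed by a square root; 9
    comes from [7 + 2 * tau <= 9 * tau]. *)
Lemma max_tau_bound (r N : nat) : 0 < r -> 0 < N ->
  (7 + 2 * max_tau (N ^ 2)) ^ r <=
  9 ^ r * ((2 * r) ^ (2 * r)) ^ (2 ^ (2 * r)) * N.
Proof.
move=> r0 N0; set D := (_ ^ (2 ^ (2 * r))).
have D0 : 0 < D by rewrite !expn_gt0 muln_gt0 r0.
have ord_gt0 : 0 < #|'I_(N ^ 2).+1| by rewrite card_ord.
have [i0 iE] := bigop.eq_bigmax (fun i : 'I_(N ^ 2).+1 => size (divisors i)) ord_gt0.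
have tau_le : max_tau (N ^ 2) ^ (2 * r) <= D * N ^ 2.
  rewrite /max_tau iE; case: (posnP i0) => [->|i0_gt0].
    by rewrite exp1n muln_gt0 D0 expn_gt0 N0.
  apply: leq_trans (divisor_bound _ i0_gt0) _; first by rewrite muln_gt0.
  by rewrite leq_mul2l -ltnS ltn_ord orbT.
have tau_gt0 : 0 < max_tau (N ^ 2).
  have lt1 : 1 < (N ^ 2).+1 by rewrite ltnS expn_gt0 N0.
  by apply: leq_trans (leq_bigmax (Ordinal lt1)).
rewrite -(leq_exp2r _ _ (ltn0Sn 1)) -expnM [r * 2]mulnC.
apply: (@leq_trans ((9 * max_tau (N ^ 2)) ^ (2 * r))).
  by rewrite leq_exp2r ?muln_gt0 //; lia.
rewrite expnMn [leqRHS]expnMn [in leqRHS]expnMn -[(9 ^ r) ^ 2]expnM [r * 2]mulnC.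
rewrite -mulnA leq_mul2l; apply/orP; right.
apply: leq_trans tau_le _; rewrite leq_mul2r; apply/orP; right.
by rewrite expnS expn1 leq_pmulr.
Qed.

End Optimization.

(** This is [J <= K' N ^ (2 k^2 / (k+1) + 1 / ((k+1) m))] with the fractional exponents cleared. *)
Lemma energy_bound (k m : nat) : (0 < k)%N -> (0 < m)%N ->
  exists K : nat,
  forall (C : numClosedFieldType) (p : nat) (e : 'F_p -> C) (M : int) (N : nat),
    prime p -> additive_char e -> (0 < N <= p)%N ->
    (forall i, (i < N)%N -> pt p M i != 0) ->
    (N ^ (2 * k) < p ^ k.+1)%N ->
    (energy k (fun=> 1) (fun i : 'I_N => (pt p M i)^-1) ^ (k.+1 * m) <=
     K * N ^ (2 * k ^ 2 * m + 1))%N.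
Proof.
move=> k0 m0.
pose K0 := (2 ^ (6 * k) * (4 * k ^ (2 * k)))%N.
(* With this exponent the factor [H ^ 2], raised to the power [k.+1 * m], costs a single factor
   [N]. *)
pose r := (2 * (k.+1 * m))%N.
have r0 : (0 < r)%N by rewrite !muln_gt0.
pose K1 := (9 ^ r * ((2 * r) ^ (2 * r)) ^ (2 ^ (2 * r)))%N.
exists (K0 ^ (k.+1 * m) * 2 ^ (k.+1 * m) * K1)%N.
move=> C p e M N pr_p e_char /andP [N0 Np] pt0 Npk.
have [T [U [[T0 U0 UT NUT NU] /andP [NT TN]]]] := numeric_params k0 N0 Npk.
pose H := (7 + 2 * max_tau (N ^ 2))%N.
have H_div n : (0 < n <= N ^ 2)%N -> (2 * size (divisors n) <= H)%N.
  move=> /andP [_ nN]; rewrite -ltnS in nN.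
  apply: (@leq_trans (2 * max_tau (N ^ 2))); last exact: leq_addl.
  by rewrite leq_mul2l; apply: (leq_bigmax (Ordinal nN)).
have H7 : (7 <= H)%N by apply: leq_addr.
have H0 : (0 < H)%N by apply: leq_trans H7.
have := energy_inv_pt_le pr_p Np U0 T0 UT NU H7 H_div pt0 e_char k0.
set J := energy _ _ _ => main.
have J_le := energy_numeric_le k0 N0 T0 H0 UT NUT NT main.
have Hr := max_tau_bound r0 N0.
apply: leq_trans (leq_expl (k.+1 * m) J_le) _.
rewrite -/K0 expnMn expnMn expnMn -[((H ^ 2) ^ _)%N]expnM -/r.
have TT : (T ^ (k.+1 * m) <= 2 ^ (k.+1 * m) * N ^ (2 * m))%N.
  by rewrite expnM [(2 ^ _)%N]expnM [(N ^ (2 * m))%N]expnM -expnMn leq_expl.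
apply: leq_trans (leq_mul (leqnn _) (leq_mul (leq_mul (leqnn _) TT) Hr)) _.
rewrite -/K1 -expnM.
have -> : (2 * k ^ 2 * m + 1 = 2 * k.-1 * (k.+1 * m) + 2 * m + 1)%N.
  by case: (k) k0 => // k' _; rewrite /=; ring.
by rewrite !expnD expn1; apply: eq_leq; ring.
Qed.

(** * The character [e_p] and the final bound *)

Section StandardCharacter.
Variables (R : realType) (p : nat).
Hypothesis pr_p : prime p.

Let root_exp (n : nat) : R[i] :=
  let t : R := 2 * pi * n%:R / p%:R in cos t +i* sin t.

Let root_expD m n : root_exp (m + n) = root_exp m * root_exp n.
Proof.
rewrite /root_exp natrD mulrDr mulrDl cosD sinD; apply/eqP.
by rewrite eq_complex /= eqxx /= addrC.
Qed.

Let root_exp_p : root_exp p = 1.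
Proof.
rewrite /root_exp mulfK ?pnatr_eq0 -?lt0n ?prime_gt0 //.
by rewrite mulr_natl cos2pi mulr2n sinDpi sinpi oppr0.
Qed.

Let root_exp_mod n : root_exp (n %% p) = root_exp n.
Proof.
rewrite [in RHS](divn_eq n p) root_expD; elim: (n %/ p)%N => [|q IHq].
  rewrite mul0n.
  have -> : root_exp 0 = 1 by rewrite /root_exp mulr0 mul0r cos0 sin0.
  by rewrite mul1r.
by rewrite mulSn root_expD root_exp_p mul1r.
Qed.

Lemma e_D : {morph @e_ R p : x y / x + y >-> x * y}.
Proof.
move=> x y; rewrite -[LHS]/(root_exp (x + y)%R) -[RHS]/(root_exp x * root_exp y).
rewrite -root_expD -[RHS]root_exp_mod; congr root_exp.
by rewrite /= {3}(Fp_cast pr_p).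
Qed.

Lemma norm_e_ (x : 'F_p) : `|e_ R x| = 1.
Proof. by rewrite normc_def /= cos2Dsin2 sqrtr1. Qed.

(** The real part is [1 - 2 sin(pi / p) ^ 2], and the sine is positive. *)
Lemma e_1_neq1 : e_ R (1 : 'F_p) != 1.
Proof.
have p1 := prime_gt1 pr_p.
have p0 : 0 < p%:R :> R by rewrite ltr0n ltnW.
have -> : e_ R (1 : 'F_p) = root_exp 1.
  by congr root_exp; rewrite /= modn_small // (Fp_cast pr_p).
rewrite /root_exp eq_complex /= negb_and; apply/orP; left.
pose s : R := pi / p%:R.
have -> : 2 * pi * 1%:R / p%:R = s + s by rewrite /s; field; rewrite gt_eqF.
have s_gt0 : 0 < sin s.
  apply: sin_gt0_pi; rewrite divr_gt0 ?pi_gt0 //=.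
  by rewrite ltr_pdivrMr // ltr_pMr ?pi_gt0 // ltr1n.
rewrite cosD -!expr2.
have := cos2Dsin2 s => cs.
have s2 : 0 < sin s ^+ 2 by rewrite exprn_gt0.
by apply/eqP => c1; lra.
Qed.

(** The coefficient [a] is absorbed into the character. The complete sum vanishes because
    translation by 1 multiplies it by [e_ R 1], which is not 1. *)
Lemma additive_char_e_ (a : 'F_p) : a != 0 -> additive_char (fun x => e_ R (a * x)).
Proof.
move=> a0; split=> [x y|x|x x0]; rewrite ?mulrDr ?e_D ?norm_e_ //.
have sum0 : \sum_(y : 'F_p) e_ R y = 0.
  apply/eqP; have : (e_ R (1 : 'F_p) - 1) * \sum_(y : 'F_p) e_ R y == 0.
    rewrite mulrBl mul1r subr_eq0 mulr_sumr.
    rewrite [X in _ == X](reindex (fun y => 1 + y)) /=.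
      by apply/eqP/eq_bigr => y _; rewrite e_D.
    by exists (fun y => y - 1) => y _; rewrite addrC ?addKr ?subrK // addrK.
  by rewrite mulf_eq0 subr_eq0 (negPf e_1_neq1).
rewrite -[RHS]sum0 [RHS](reindex (fun y => a * (y * x))) //.
exists (fun y => a^-1 * y / x) => y _; first by rewrite mulKf // mulfK.
by rewrite mulfVK // mulVKf.
Qed.

End StandardCharacter.

Lemma pt_inj (p : nat) (M : int) (N i j : nat) : prime p -> (N <= p)%N ->
  (i < N)%N -> (j < N)%N -> pt p M i = pt p M j -> i = j.
Proof.
move=> pr_p Np iN jN /eqP; rewrite /pt !intrD (inj_eq (addrI _)) -!pmulrn.
rewrite !mulrS (inj_eq (addrI _)) Fp_nat_inj ?(leq_trans iN) ?(leq_trans jN) //.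
by move/eqP.
Qed.

Lemma interval_sum {V : nmodType} (p : nat) (M : int) (N : nat) (F : 'F_p -> V) :
  prime p -> (N <= p)%N ->
  \sum_(x in [set ((M + i.+1%:Z)%:~R : 'F_p) | i : 'I_N]) F x =
  \sum_(i < N) F (pt p M i).
Proof.
move=> pr_p Np; rewrite big_imset //= => i j _ _ ij.
by apply/val_inj/(pt_inj pr_p Np (ltn_ord i) (ltn_ord j) ij).
Qed.

(** The right side minus the left is exactly [L * eps - (l + 1)], and [m * eps >= 1] makes it
    nonnegative. *)
Lemma exponent_le {R : realType} (k l m L : nat) (eps : R) :
  (0 < k)%N -> (0 < l)%N -> 1 <= m%:R * eps ->
  L = (2 * k * l * ((k + 1) * (l + 1) * m))%N ->
  (2 * k * l.-1 * ((k + 1) * (l + 1) * m) + (2 * k ^ 2 * m + 1) * (l + 1))%:R <=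
  L%:R * (1 + eps) - L%:R * (1 / (l * (k + 1))%:R) :> R.
Proof.
move=> k0 l0 meps LE.
have k0R : 0 < k%:R :> R by rewrite ltr0n.
have l0R : 1 <= l%:R :> R by rewrite ler1n.
have k1R : 1 <= k%:R :> R by rewrite ler1n.
have lE : l.-1%:R = l%:R - 1 :> R by rewrite -subn1 natrB.
have -> : L%:R * (1 / (l * (k + 1))%:R) = 2 * k%:R * (l%:R + 1) * m%:R :> R.
  rewrite LE !natrM !natrD; field.
  by apply/andP; split; lra.
rewrite !natrD !natrM lE LE !natrM !natrD.
have key : (l%:R + 1) <= 2 * k%:R * l%:R * ((k%:R + 1) * (l%:R + 1) * m%:R) * eps :> R.
  have -> : 2 * k%:R * l%:R * ((k%:R + 1) * (l%:R + 1) * m%:R) * eps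
    = (l%:R + 1) * ((2 * k%:R * l%:R * (k%:R + 1)) * (m%:R * eps)) by ring.
  rewrite ler_peMr; [by []|by lra|].
  rewrite mulr_ege1 //; rewrite !mulr_ege1 //; lra.
rewrite -subr_ge0.
move: key; rewrite -subr_ge0 => key; apply: le_trans key _.
by rewrite le_eqVlt; apply/orP; left; apply/eqP; ring.
Qed.

Lemma powR_exprn {R : realType} (x r : R) (n : nat) :
  (x `^ r) ^+ n = x `^ (n%:R * r).
Proof. by rewrite -powR_mulrn ?powR_ge0 // -powRrM mulrC. Qed.

Lemma nat_pow_lt_of_powR {R : realType} (k N p : nat) : (0 < k)%N ->
  N%:R < p%:R `^ ((k + 1)%:R / (2 * k)%:R) :> R -> (N ^ (2 * k) < p ^ k.+1)%N.
Proof.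
move=> k0 Np; rewrite -(ltr_nat R) !natrX.
have k2 : (0 < 2 * k)%N by rewrite muln_gt0.
have -> : p%:R ^+ k.+1 = (p%:R `^ ((k + 1)%:R / (2 * k)%:R)) ^+ (2 * k) :> R.
  rewrite powR_exprn mulrCA mulfV ?mulr1; last by rewrite pnatr_eq0 -lt0n.
  by rewrite addn1 powR_mulrn.
by rewrite ltr_pXn2r ?nnegrE ?powR_ge0.
Qed.

(** Both sides are compared after raising to the power [L], which clears all denominators;
    [K < K.+1 ^ L] gives the strict inequality. *)
Lemma root_bound {R : realType} (k1 k2 m K N1 N2 p : nat) (eps s : R) :
  (0 < k1)%N -> (0 < k2)%N -> (0 < N1)%N -> (0 < N2)%N -> (0 < p)%N ->
  1 <= m%:R * eps -> 0 <= s ->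
  let E := ((k1 + 1) * (k2 + 1) * m)%N in
  s ^+ (2 * k1 * k2 * E) <=
    (K * N1 ^ (2 * k1 * k2.-1 * E + (2 * k1 ^ 2 * m + 1) * (k2 + 1))
       * N2 ^ (2 * k2 * k1.-1 * E + (2 * k2 ^ 2 * m + 1) * (k1 + 1)) * p ^ E)%:R ->
  s < K.+1%:R * (p%:R `^ (1 / (2 * k1 * k2)%:R)
              * N1%:R `^ (- (1 / (k2 * (k1 + 1))%:R))
              * N2%:R `^ (- (1 / (k1 * (k2 + 1))%:R)))
           * (N1 * N2)%:R `^ (1 + eps).
Proof.
move=> k1_gt0 k2_gt0 N1_gt0 N2_gt0 p_gt0 meps s0 E sL.
have m_gt0 : (0 < m)%N by case: m meps {E sL} => //; rewrite mul0r ler10.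
set L := (2 * k1 * k2 * E)%N in sL *.
have L_gt0 : (0 < L)%N by rewrite /L /E !muln_gt0 k1_gt0 k2_gt0 m_gt0 !addn1.
set rhs := (X in _ < X).
have rhs0 : 0 <= rhs by rewrite /rhs !mulr_ge0 ?powR_ge0.
rewrite -(ltr_pXn2r L_gt0) ?nnegrE //; apply: le_lt_trans sL _.
have N1R : 1 <= N1%:R :> R by rewrite ler1n.
have N2R : 1 <= N2%:R :> R by rewrite ler1n.
have rhsE : rhs ^+ L = K.+1%:R ^+ L * (p%:R ^+ E *
    N1%:R `^ (L%:R * (1 + eps) - L%:R * (1 / (k2 * (k1 + 1))%:R)) *
    N2%:R `^ (L%:R * (1 + eps) - L%:R * (1 / (k1 * (k2 + 1))%:R))).
  rewrite /rhs (natrM _ N1 N2) powRM ?ler0n // !exprMn !powR_exprn.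
  have -> : L%:R * (1 / (2 * k1 * k2)%:R) = E%:R :> R.
    rewrite /L natrM mul1r mulrAC mulfV ?mul1r //.
    by rewrite pnatr_eq0 -lt0n !muln_gt0 k1_gt0.
  rewrite powR_mulrn ?ler0n // !(mulrN L%:R) !powRD; last 2 first.
  - by rewrite pnatr_eq0 -lt0n N2_gt0 implybT.
  - by rewrite pnatr_eq0 -lt0n N1_gt0 implybT.
  by ring.
rewrite {}rhsE.
set y1 := N1%:R `^ _; set y2 := N2%:R `^ _.
set n1 := (_ + _ * (k2 + 1))%N; set n2 := (_ + _ * (k1 + 1))%N.
have y1_ge : N1%:R ^+ n1 <= y1.
  by rewrite -powR_mulrn ?ler0n //; apply: ler_powR => //; apply: exponent_le.
have y2_ge : N2%:R ^+ n2 <= y2.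
  rewrite -powR_mulrn ?ler0n //; apply: ler_powR => //.
  have LE : L = (2 * k2 * k1 * ((k2 + 1) * (k1 + 1) * m))%N.
    by rewrite /L /E [((k2 + 1) * _)%N]mulnC [(2 * k2 * k1)%N]mulnAC.
  have := exponent_le k2_gt0 k1_gt0 meps LE.
  by rewrite /n2 /E [((k2 + 1) * (k1 + 1))%N]mulnC.
have -> : (K * N1 ^ n1 * N2 ^ n2 * p ^ E)%:R =
    K%:R * (p%:R ^+ E * N1%:R ^+ n1 * N2%:R ^+ n2) :> R.
  by rewrite !(natrM R (_ * _)) natrM !natrX -!mulrA; congr (_ * _); rewrite mulrA mulrC.
have K_lt : K%:R < K.+1%:R ^+ L :> R.
  by rewrite -natrX ltr_nat; have := leq_pexp2l (ltn0Sn K) L_gt0; rewrite expn1.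
have N1n : 0 < N1%:R ^+ n1 :> R by rewrite exprn_gt0 // ltr0n.
have N2n : 0 < N2%:R ^+ n2 :> R by rewrite exprn_gt0 // ltr0n.
have pE : 0 < p%:R ^+ E :> R by rewrite exprn_gt0 // ltr0n.
apply: (@lt_le_trans _ _ (K.+1%:R ^+ L * (p%:R ^+ E * N1%:R ^+ n1 * N2%:R ^+ n2))).
  by rewrite ltr_pM2r // !mulr_gt0.
rewrite ler_wpM2l ?exprn_ge0 // -!mulrA ler_wpM2l ?(ltW pE) //.
exact: ler_pM (ltW N1n) (ltW N2n) y1_ge y2_ge.
Qed.

Theorem theorem10 (R : realType) (k1 k2 : nat) (hk1 : (0 < k1)%N)
    (hk2 : (0 < k2)%N) (eps : R) (heps : 0 < eps) :
  exists c : R, 0 < c /\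
    forall (p : nat), prime p ->
    forall (N1 N2 : nat) (I1 I2 : {set 'F_p}),
      is_interval N1 I1 -> is_interval N2 I2 ->
      0 \notin I1 -> 0 \notin I2 ->
      N1%:R < p%:R `^ ((k1 + 1)%:R / (2 * k1)%:R) :> R ->
      N2%:R < p%:R `^ ((k2 + 1)%:R / (2 * k2)%:R) :> R ->
    forall (alpha1 alpha2 : 'F_p -> R[i]),
      (forall x1, x1 \in I1 -> `|alpha1 x1| <= 1) ->
      (forall x2, x2 \in I2 -> `|alpha2 x2| <= 1) ->
    forall a : int, coprimez a p ->
      `|bilinear_Kloosterman_sum I1 I2 alpha1 alpha2 a| <
        (c * (p%:R `^ (1 / (2 * k1 * k2)%:R)
              * N1%:R `^ (- (1 / (k2 * (k1 + 1))%:R))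
              * N2%:R `^ (- (1 / (k1 * (k2 + 1))%:R)))
           * (N1 * N2)%:R `^ (1 + eps))%:C.
Proof.
pose m := Num.bound eps^-1.
have meps : 1 <= m%:R * eps.
  rewrite -ler_pdivrMr // div1r; apply/ltW/archi_boundP.
  by rewrite invr_ge0 ltW.
have m_gt0 : (0 < m)%N by case: (m) meps => //; rewrite mul0r ler10.
have [K1 J1_le] := energy_bound hk1 m_gt0.
have [K2 J2_le] := energy_bound hk2 m_gt0.
(* The energy bounds for exponents [k1.+1 * m] and [k2.+1 * m] are raised to [k2 + 1] and [k1 + 1]
   to reach a common exponent. *)
exists (K1 ^ (k2 + 1) * K2 ^ (k1 + 1)).+1%:R; split; first by rewrite ltr0n.
move=> p pr_p N1 N2 I1 I2 [/andP [N1_gt0 N1p] [M1 I1E]] [/andP [N2_gt0 N2p] [M2 I2E]].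
move=> I1_0 I2_0 N1_lt N2_lt al1 al2 al1_le al2_le a cop_a.
have pt_mem M N (i : 'I_N) : pt p M i \in [set ((M + i.+1%:Z)%:~R : 'F_p) | i : 'I_N].
  by apply/imsetP; exists i.
have pt1 (i : 'I_N1) : pt p M1 i \in I1 by rewrite I1E.
have pt2 (i : 'I_N2) : pt p M2 i \in I2 by rewrite I2E.
have pt1_neq0 i : (i < N1)%N -> pt p M1 i != 0.
  by move=> iN; apply: contraNneq I1_0 => <-; apply: (pt1 (Ordinal iN)).
have pt2_neq0 i : (i < N2)%N -> pt p M2 i != 0.
  by move=> iN; apply: contraNneq I2_0 => <-; apply: (pt2 (Ordinal iN)).
have a_neq0 : a%:~R != 0 :> 'F_p.
  rewrite -(dvdz_pcharf (pchar_Fp pr_p)); apply/negP => pa.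
  move: cop_a; rewrite /coprimez; have /gcdz_idPr -> := pa.
  by rewrite /= => /eqP [] p1; rewrite p1 in pr_p.
have e_char := additive_char_e_ R pr_p a_neq0.
set S := bilinear_Kloosterman_sum _ _ _ _ _.
pose h1 (i : 'I_N1) := (pt p M1 i)^-1.
pose h2 (i : 'I_N2) := (pt p M2 i)^-1.
have SE : S = \sum_(i < N1) \sum_(j < N2)
    al1 (pt p M1 i) * al2 (pt p M2 j) * e_ R (a%:~R * (h1 i * h2 j)).
  rewrite /S /bilinear_Kloosterman_sum I1E interval_sum //.
  apply: eq_bigr => i _; rewrite I2E interval_sum //.
  by apply: eq_bigr => j _; rewrite mulrA.
have S_le := bilinear_le_energy pr_p e_char h1 h2 hk1 hk2
  (fun i => al1_le _ (pt1 i)) (fun j => al2_le _ (pt2 j)).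
rewrite -SE !card_ord in S_le.
have {}J1_le := J1_le _ _ _ M1 N1 pr_p e_char.
rewrite N1_gt0 N1p in J1_le.
have {}J1_le := J1_le isT pt1_neq0 (nat_pow_lt_of_powR hk1 N1_lt).
have {}J2_le := J2_le _ _ _ M2 N2 pr_p e_char.
rewrite N2_gt0 N2p in J2_le.
have {}J2_le := J2_le isT pt2_neq0 (nat_pow_lt_of_powR hk2 N2_lt).
rewrite -/h1 -/h2 in J1_le J2_le.
set J1 := energy k1 _ _ in S_le J1_le; set J2 := energy k2 _ _ in S_le J2_le.
(* The real number [s] is the modulus of [S], which moves the inequality from [R[i]] to [R]. *)
set s := Num.sqrt (complex.Re S ^+ 2 + complex.Im S ^+ 2).
have sE : `|S| = s%:C by rewrite normc_def.
rewrite sE ltcR.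
have s_ge0 : 0 <= s by apply: sqrtr_ge0.
apply: (root_bound hk1 hk2 N1_gt0 N2_gt0 (prime_gt0 pr_p) meps s_ge0).
set E := ((k1 + 1) * (k2 + 1) * m)%N.
have {}S_le : s ^+ (2 * k1 * k2) <=
    (N1 ^ (2 * k1 * k2.-1) * N2 ^ (2 * k2 * k1.-1) * (p * J1 * J2))%:R.
  by rewrite -lecR rmorphXn /= -sE rmorph_nat.
rewrite exprM; apply: le_trans (lerXn2r _ _ _ S_le) _; rewrite ?nnegrE ?exprn_ge0 ?sqrtr_ge0 //.
rewrite -natrX ler_nat !expnMn -!expnM.
have J1E : (J1 ^ E <= K1 ^ (k2 + 1) * N1 ^ ((2 * k1 ^ 2 * m + 1) * (k2 + 1)))%N.
  have -> : E = (k1.+1 * m * (k2 + 1))%N by rewrite /E addn1 mulnAC.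
  by rewrite expnM [(N1 ^ _)%N]expnM -expnMn leq_expl.
have J2E : (J2 ^ E <= K2 ^ (k1 + 1) * N2 ^ ((2 * k2 ^ 2 * m + 1) * (k1 + 1)))%N.
  have -> : E = (k2.+1 * m * (k1 + 1))%N.
    by rewrite /E [(k2 + 1)%N]addn1 -mulnA mulnC.
  by rewrite expnM [(N2 ^ _)%N]expnM -expnMn leq_expl.
apply: leq_trans (leq_mul (leqnn _) (leq_mul (leq_mul (leqnn _) J1E) J2E)) _.
by rewrite !expnD; apply: eq_leq; ring.
Qed.
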